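(* Let $\mathcal{X}\subseteq\mathbb{R}^n$ be a nonempty convex polyhedron, $a_0\in\mathbb{R}^n$, let $\mathcal{V}\subset\mathbb{R}^n$ be compact, smooth and strictly convex with $0\in\mathrm{int}(\mathcal{V})$, and let $\varphi(\cdot)=g(\|\cdot\|_{\mathcal{V}^{\circ}})$, where $g:\mathbb{R}\to[0,\infty)$ is Legendre with $g(0)=0$ and $g'(0)=0$. Let $\{x_k\}$ be the proximal path for $\min_{x\in\mathcal{X}}\langle a_0,x\rangle$ induced by $\varphi$, initialized at $x_0=x_{\mathrm{R}}=\arg\min_{x\in\mathcal{X}}\varphi(x)$ and associated with step sizes $\{\lambda_k>0\}$ satisfying $\sum_{k=0}^{\infty}\lambda_k^{-1}=\infty$. Assume that $\Pi^{\varphi}_{\mathcal{X}}(0)=\Pi^{\varphi}_{\mathrm{Aff}(\mathcal{X})}(0)$ and that $\{x_k\}$ is monotone on $\mathcal{X}$. Then for every $k\ge1$, $$x_k\in\arg\min_{x\in\mathcal{X}}\ \max_{\xi\in\Xi(r_k,\mathcal{V})}\langle a_0+\xi,x\rangle,$$ where $r_k=\omega_k\, g'\left(\|x_k\|_{\mathcal{V}^{\circ}}\right)$ with $\omega_k=\left(\lambda_0^{-1}+\dots+\lambda_{k-1}^{-1}\right)^{-1}$.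
   Context: For a closed convex set $\mathcal{C}\subseteq\mathbb{R}^n$ containing $0$: the gauge is $\|v\|_{\mathcal{C}}=\inf\{t\ge0: v\in t\mathcal{C}\}$ and the polar is $\mathcal{C}^{\circ}=\{y:\langle x,y\rangle\le1\ \forall x\in\mathcal{C}\}$. $\Xi(r,\mathcal{V})=\{\xi\in\mathbb{R}^n:\|\xi\|_{\mathcal{V}}\le r\}$. $\mathrm{Aff}(\mathcal{X})$ is the affine hull. A convex set with nonempty interior is strictly convex if for distinct boundary points the open segment between them lies in the interior; it is smooth if the supporting hyperplane at each boundary point is unique. A proper closed convex function $\psi:\mathbb{R}^n\to\mathbb{R}\cup\{+\infty\}$ is Legendre if $\mathrm{int}(\mathrm{dom}\,\psi)\ne\varnothing$, $\psi$ is differentiable and strictly convex on $\mathrm{int}(\mathrm{dom}\,\psi)$, and $\|\nabla\psi(x_n)\|_2\to\infty$ whenever $x_n\in\mathrm{int}(\mathrm{dom}\,\psi)$ converges to a boundary point of $\mathrm{dom}\,\psi$. Bregman divergence: $D_\varphi(x,y)=\varphi(x)-\varphi(y)-\langle\nabla\varphi(y),x-y\rangle$. Bregman projection onto a closed convex set $\mathcal{S}$: $\Pi^{\varphi}_{\mathcal{S}}(y)=\arg\min_{x\in\mathcal{S}}D_\varphi(x,y)$. Proximal path: $x_{k+1}=\arg\min_{x\in\mathcal{X}}\langle a_0,x\rangle+\lambda_kD_\varphi(x,x_k)$, $k=0,1,\dots$. Likewise the central path and robust path points $\arg\min_{x\in\mathcal{X}}\langle a_0,x\rangle+\omega D_\varphi(x,x_{\mathrm{R}})$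 and $\arg\min_{x\in\mathcal{X}}\langle a_0,x\rangle+\omega\varphi(x)$, $\omega>0$, as well as the proximal iterates, are taken to exist (they are then unique by strict convexity). The proximal path is monotone on the convex polyhedron $\mathcal{X}$ if for every face $\mathcal{F}$ of $\mathcal{X}$ and every $k\ge0$: $x_k\in\mathcal{F}$ implies $x_{k+n}\in\mathcal{F}$ for all $n\ge1$. *)

(* Defs.v *)
(* Vectors of R^n are row vectors over R : realType. *)
From HB Require Import structures.
From mathcomp Require Import all_boot all_order all_algebra.
From mathcomp Require Import all_classical all_reals all_analysis.

Set Implicit Arguments.
Unset Strict Implicit.
Unset Printing Implicit Defensive.

Import Order.TTheory GRing.Theory Num.Theory.
Import numFieldNormedType.Exports.

Local Open Scope classical_set_scope.
Local Open Scope ring_scope.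

Section Euclidean.
Context {R : realType} {n : nat}.
Implicit Types (x y v : 'rV[R]_n) (f : 'rV[R]_n -> R) (C S X F H : set 'rV[R]_n).

Definition dotp x y : R := \sum_(i < n) x 0 i * y 0 i.

(* The norm carried by 'rV[R]_n in the library is the sup norm. *)
Definition norm2 x : R := Num.sqrt (dotp x x).

Definition gradient f x : 'rV[R]_n := \row_i 'D_(delta_mx 0 i) f x.

Definition boundary C : set 'rV[R]_n := closure C `\` interior C.

Definition argmin S f : set 'rV[R]_n :=
  [set x | S x /\ forall y, S y -> f x <= f y].

(* Extended-real valued: the gauge is +oo when no multiple of C contains v. *)
Definition gauge C v : \bar R :=
  ereal_inf [set t%:E | t in
    [set t : R | 0 <= t /\ exists2 c, C c & v = t *: c]].

Definition polar C : set 'rV[R]_n :=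
  [set y | forall x, C x -> dotp x y <= 1].

Definition Xi (r : R) C : set 'rV[R]_n := [set xi | (gauge C xi <= r%:E)%E].

Definition affine_set S :=
  forall x y (t : R), S x -> S y -> S (t *: x + (1 - t) *: y).

Definition Aff X : set 'rV[R]_n := smallest affine_set X.

Definition strictly_convex_set C :=
  [/\ convex_set (C : set (convex_lmodType 'rV[R]_n)),
      interior C !=set0 &
      forall x y (t : R), boundary C x -> boundary C y -> x <> y ->
        0 < t < 1 -> interior C (t *: x + (1 - t) *: y)].

Definition supporting_hyperplane C x H :=
  exists c : 'rV[R]_n, [/\ c != 0,
    forall y, C y -> dotp c y <= dotp c x &
    H = [set z | dotp c z = dotp c x]].

Definition smooth_set C :=
  [/\ convex_set (C : set (convex_lmodType 'rV[R]_n)),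
      interior C !=set0 &
      forall x, boundary C x -> is_subset1 (supporting_hyperplane C x)].

Definition polyhedron X :=
  exists m (A : 'M[R]_(m, n)) (b : 'rV[R]_m),
    X = [set x | forall i, dotp (row i A) x <= b 0 i].

(* Faces are cut out by valid inequalities; c = 0 gives X itself and set0. *)
Definition face X F :=
  exists (c : 'rV[R]_n) (d : R),
    (forall x, X x -> dotp c x <= d) /\ F = X `&` [set x | dotp c x = d].

Definition domain (psi : 'rV[R]_n -> \bar R) : set 'rV[R]_n :=
  [set x | (psi x < +oo)%E].

Definition proper (psi : 'rV[R]_n -> \bar R) :=
  (forall x, psi x != -oo%E) /\ domain psi !=set0.

Definition convex_efun (psi : 'rV[R]_n -> \bar R) :=
  forall x y (t : R), 0 < t < 1 ->
    (psi (t *: x + (1 - t) *: y)%R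
       <= t%:E * psi x + (1 - t)%:E * psi y)%E.

Definition strictly_convex_on S (psi : 'rV[R]_n -> \bar R) :=
  forall x y (t : R), S x -> S y -> x <> y -> 0 < t < 1 ->
    (psi (t *: x + (1 - t) *: y)%R
       < t%:E * psi x + (1 - t)%:E * psi y)%E.

(* "Closed" is lower semicontinuity. On the interior of its domain a proper psi
   is finite, so fine \o psi agrees with psi near each of these points. *)
Definition legendre (psi : 'rV[R]_n -> \bar R) :=
  [/\ [/\ proper psi, lower_semicontinuous psi & convex_efun psi],
      interior (domain psi) !=set0,
      forall x, interior (domain psi) x ->
        differentiable (fine \o psi : 'rV[R]_n -> R) x,
      strictly_convex_on (interior (domain psi)) psi &
      forall (u : nat -> 'rV[R]_n) x,
        (forall k, interior (domain psi) (u k)) ->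
        u k @[k --> \oo] --> x -> boundary (domain psi) x ->
        norm2 (gradient (fine \o psi) (u k)) @[k --> \oo] --> +oo].

Definition bregman f x y : R :=
  f x - f y - dotp (gradient f y) (x - y).

Definition bregman_proj f S y : set 'rV[R]_n :=
  argmin S (fun x => bregman f x y).

Definition monotone_path X (x : nat -> 'rV[R]_n) :=
  forall F, face X F -> forall k, F (x k) -> forall m, (1 <= m)%N ->
    F (x (k + m)%N).

Definition proximal_path X (a0 : 'rV[R]_n) f (lambda : nat -> R)
    (x : nat -> 'rV[R]_n) :=
  forall k, argmin X (fun y => dotp a0 y + lambda k * bregman f y (x k))
              (x k.+1).

End Euclidean.

(* A function of one real variable as an extended-real function on R^1. *)
Definition lift1 {R : realType} (g : R -> R) : 'rV[R]_1 -> \bar R :=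
  fun t => (g (t 0 0))%:E.

(* The gauge of the polar of V is finite as soon as 0 is interior to polar V,
   in particular when V is bounded. *)
Definition polar_gauge {R : realType} {n : nat} (V : set 'rV[R]_n)
    (x : 'rV[R]_n) : R :=
  fine (gauge (polar V) x).

Definition omega {R : realType} (lambda : nat -> R) (k : nat) : R :=
  (\sum_(i < k) (lambda i)^-1)^-1.

Definition is_max {R : realType} (A : set R) (m : R) := A m /\ ubound A m.

(* Main.v *)
Require Import Defs.
From HB Require Import structures.
From mathcomp Require Import all_boot all_order all_algebra.
From mathcomp Require Import all_classical all_reals all_analysis.
From mathcomp Require Import ring lra.

Set Implicit Arguments.
Unset Strict Implicit.
Unset Printing Implicit Defensive.

Import Order.TTheory GRing.Theory Num.Theory.
Import numFieldNormedType.Exports.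

Local Open Scope classical_set_scope.
Local Open Scope ring_scope.

(** Write h for the gauge of the polar of V. It is the support function of V, so
    h x is attained at some v in V. Strict convexity of V makes this maximizer
    unique for x != 0, and hence makes h differentiable there with gradient v
    ([polar_gauge_derive]). Since g' vanishes at 0 = h 0, the kink of h at the
    origin does not hurt g (h x): everywhere its gradient is g'(h x) v with v
    maximizing ([is_derive_gauge_function]).

    The first-order condition of the k-th proximal step says that the vector
    -(lambda_k^-1 a0 + grad phi (x_(k+1)) - grad phi (x_k)) is normal to X at
    x_(k+1) ([prox_step_normal]). A normal vector at a point of X cuts out a face
    through that point, so a path that never leaves the faces it enters keeps
    every normal vector it has met ([normal_cone_monotone_path]). The conditions
    of all steps therefore hold at the same point x_k, and there they telescope
    ([prox_path_normal]): -(omega_k^-1 a0 + grad phi (x_k) - grad phi (x_0)) is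
    normal to X at x_k.

    The divergence from 0 is phi itself, because the gradient of phi vanishes at
    0. The equality of the two projections of 0 thus makes x_0 a minimizer of phi
    over the affine hull of X, so that grad phi (x_0) is orthogonal to all
    differences of points of X ([gradient_orth_of_affine_min]) and drops out.
    What is left is <a0 + omega_k grad phi (x_k), y - x_k> >= 0 for y in X.

    Finally omega_k grad phi (x_k) = r v with r = omega_k g'(h (x_k)) and v
    maximizing at x_k. The worst case of y over the uncertainty set of radius r
    is <a0, y> + r h y ([max_dotp_Xi]); it is at least <a0 + r v, y> >=
    <a0 + r v, x_k>, which is the worst case of x_k. *)

(** * The Euclidean inner product *)

Section DotProduct.
Context {R : realType} {n : nat}.
Implicit Types x y z d u v : 'rV[R]_n.

Lemma dotpC x y : dotp x y = dotp y x.
Proof. by apply: eq_bigr => i _; rewrite mulrC. Qed.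

Lemma dotpDl x y z : dotp (x + y) z = dotp x z + dotp y z.
Proof. by rewrite -big_split; apply: eq_bigr => i _; rewrite mxE mulrDl. Qed.

Lemma dotpZl (t : R) x z : dotp (t *: x) z = t * dotp x z.
Proof. by rewrite mulr_sumr; apply: eq_bigr => i _; rewrite mxE mulrA. Qed.

Lemma dotpNl x z : dotp (- x) z = - dotp x z.
Proof. by rewrite -scaleN1r dotpZl mulN1r. Qed.

Lemma dotpDr x y z : dotp z (x + y) = dotp z x + dotp z y.
Proof. by rewrite ![dotp z _]dotpC dotpDl. Qed.

Lemma dotpZr (t : R) x z : dotp z (t *: x) = t * dotp z x.
Proof. by rewrite ![dotp z _]dotpC dotpZl. Qed.

Lemma dotpNr x z : dotp z (- x) = - dotp z x.
Proof. by rewrite ![dotp z _]dotpC dotpNl. Qed.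

Definition dotpE := (dotpDl, dotpDr, dotpNl, dotpNr, dotpZl, dotpZr).

Lemma dotp0l x : dotp 0 x = 0.
Proof. by rewrite -(scale0r 0) dotpZl mul0r. Qed.

Lemma dotp_gt0 x : x != 0 -> 0 < dotp x x.
Proof.
move=> x_neq0; have sq_ge0 i : true -> 0 <= x 0 i * x 0 i.
  by rewrite -expr2 sqr_ge0.
rewrite lt_neqAle sumr_ge0 // andbT eq_sym; apply: contraNneq x_neq0.
move=> /eqP; rewrite psumr_eq0 // => /allP x_eq0; apply/eqP/rowP => i.
by have := x_eq0 i (mem_index_enum _); rewrite mulf_eq0 orbb mxE => /eqP.
Qed.

Lemma dotp_delta x i : dotp x (delta_mx 0 i) = x 0 i.
Proof.
rewrite /dotp (bigD1 i) //= mxE !eqxx mulr1 big1 ?addr0 // => j j_neqi.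
by rewrite mxE (negPf j_neqi) mulr0.
Qed.

Lemma dotp_continuous y : continuous (dotp ^~ y).
Proof.
move=> x; have x_filter : Filter (nbhs x) := nbhs_filter x.
apply: cvg_big => [|i _]; first exact: add_continuous.
by apply: cvgM; [exact: coord_continuous|exact: cvg_cst].
Qed.

End DotProduct.

(** * Directional derivatives *)

Section DirectionalDerivatives.
Context {R : realType} {E : normedModType R}.
Implicit Types (x d : E) (f : E -> R).

Lemma is_deriveP f x d l :
  t^-1 * (f (x + t *: d) - f x) @[t --> 0^'] --> l <-> is_derive x d f l.
Proof.
have quotE : (fun t => t^-1 *: ((f \o shift x) (t *: d) - f x)) =
    (fun t => t^-1 * (f (x + t *: d) - f x)).
  by apply/funext => t /=; rewrite [x + _]addrC.
split=> [fl|[fd <-]].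
  split; first by rewrite /derivable quotE; apply/cvg_ex; exists l.
  rewrite /derive quotE; apply: cvg_lim => //; exact: fl.
by rewrite /derive -quotE; exact: fd.
Qed.

Lemma derive_ge0_of_min f x d l :
  is_derive x d f l ->
  (forall t, 0 < t < 1 -> f x <= f (x + t *: d)) -> 0 <= l.
Proof.
move=> /is_deriveP/cvg_dnbhs_at_right fl fmin.
rewrite -(cvg_lim _ fl) //; apply: limr_ge; first by apply/cvg_ex; exists l.
near=> t.
have t_gt0 : 0 < t by near: t; exact: nbhs_right_gt.
rewrite mulr_ge0 ?invr_ge0 ?(ltW t_gt0) // subr_ge0; apply: fmin.
by rewrite t_gt0 /=; near: t; exact: nbhs_right_lt.
Unshelve. all: by end_near. Qed.

End DirectionalDerivatives.

(** The gradient is built from partial derivatives only; it is a true gradient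
    as soon as all directional derivatives come from one linear form. *)
Lemma gradientE {R : realType} {n : nat} (f : 'rV[R]_n -> R) x p :
  (forall d, is_derive x d f (dotp p d)) -> gradient f x = p.
Proof.
by move=> fp; apply/rowP => i; rewrite mxE derive_val dotp_delta.
Qed.

(** A chain rule for g after F at 0 in which F need not be differentiable: it is
    enough that F is Lipschitz at 0, because then the quotient for g after F and
    g'(F 0) times the quotient for F have difference o(1). When g'(F 0) = 0, this
    covers a function F with a kink. *)
Lemma cvg_diffquot_comp {R : realType} (g F : R -> R) (M l : R) :
  derivable g (F 0) 1 ->
  (forall t, `|F t - F 0| <= M * `|t|) ->
  derive1 g (F 0) * (t^-1 * (F t - F 0)) @[t --> 0^'] --> l ->
  t^-1 * (g (F t) - g (F 0)) @[t --> 0^'] --> l.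
Proof.
set a := F 0; set dg := derive1 g a => gd FM gFl.
have M_ge0 : 0 <= M by have := FM 1; rewrite normr1 mulr1; apply: le_trans.
have gE : h^-1 * (g (h + a) - g a) @[h --> 0^'] --> dg.
  move: gd; rewrite /derivable /dg /derive1 /=.
  by under eq_fun do rewrite [_%:A]mulr1.
suff err0 : t^-1 * (g (F t) - g a) - dg * (t^-1 * (F t - a)) @[t --> 0^'] --> 0.
  rewrite -[l]add0r.
  have -> : (fun t => t^-1 * (g (F t) - g a)) =
      (fun t => (t^-1 * (g (F t) - g a) - dg * (t^-1 * (F t - a))) +
                dg * (t^-1 * (F t - a))).
    by apply/funext => t; rewrite subrK.
  exact: cvgD.
apply/cvgrPdist_le => e e_gt0.
have e1_gt0 : 0 < e / (M + 1) by rewrite divr_gt0 // ltr_wpDl.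
have /cvgrPdist_le/(_ _ e1_gt0) := gE.
rewrite -nbhs_nearE => -[/= delta /= delta_gt0 gdelta].
near=> t.
have t_neq0 : t != 0 by near: t; exact: nbhs_dnbhs_neq.
have t_small : `|t| < delta / (M + 1).
  by near: t; apply: dnbhs0_lt; rewrite divr_gt0 // ltr_wpDl.
have nt_gt0 : 0 < `|t| by rewrite normr_gt0.
rewrite sub0r normrN mulrCA -mulrBr normrM normfV ler_pdivrMl //.
have FMt : `|F t - a| <= M * `|t| := FM t.
set h := F t - a in FMt *.
have -> : F t = h + a by rewrite subrK.
have [->|h_neq0] := eqVneq h 0.
  by rewrite add0r subrr mulr0 subrr normr0 mulr_ge0 // ltW.
have nh_gt0 : 0 < `|h| by rewrite normr_gt0.
have h_small : `|h| < delta.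
  apply: le_lt_trans FMt _; rewrite ltr_pdivlMr ?ltr_wpDl // in t_small.
  by apply: le_lt_trans t_small; rewrite mulrC ler_pM2l // lerDl.
have := gdelta h; rewrite /ball_ /= sub0r normrN => /(_ h_small h_neq0).
rewrite -(ler_pM2r nh_gt0) -normrM mulrBl mulrAC mulVf // mul1r distrC.
move=> /le_trans; apply; rewrite [leRHS]mulrC -mulrA ler_pM2l //.
rewrite ler_pdivrMl ?ltr_wpDl //; apply: le_trans FMt _.
by rewrite ler_pM2r // lerDl.
Unshelve. all: by end_near. Qed.

(** * The polar gauge as a support function *)

Section SupportFunction.
Context {R : realType} {n : nat} (V : set 'rV[R]_n).
Hypotheses (V_compact : compact V) (V_int0 : interior V 0).
Implicit Types x v w d xi : 'rV[R]_n.

Let h := polar_gauge V.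

Let V0 : V 0 := interior_subset V_int0.

(** The gauge of the polar is the support function: t > 0 bounds <., x> on V
    exactly when x / t is in the polar. *)
Lemma polar_gaugeP x : exists2 v, V v &
  dotp v x = h x /\ (forall w, V w -> dotp w x <= h x).
Proof.
have [v /set_mem Vv vmax] : exists2 v, v \in V &
    forall w, w \in V -> dotp w x <= dotp v x.
  apply: EVT_max_rV => //; first by exists 0.
  by apply: continuous_subspaceT => u; exact: dotp_continuous.
have {}vmax w : V w -> dotp w x <= dotp v x by move=> /mem_set/vmax.
have m_ge0 : 0 <= dotp v x by rewrite -(dotp0l x); exact: vmax.
suff -> : h x = dotp v x by exists v.
rewrite /h /polar_gauge /gauge; set E := [set _ | _ in _].
suff -> : ereal_inf E = (dotp v x)%:E by [].
apply/eqP; rewrite eq_le; apply/andP; split.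
  (* Scaling by the maximum plus e instead of the maximum avoids dividing by 0. *)
  apply/lee_addgt0Pr => e e_gt0; apply: ereal_inf_lbound.
  have me_gt0 : 0 < dotp v x + e by rewrite ltr_wpDl.
  exists (dotp v x + e) => //; split; first exact: ltW.
  exists ((dotp v x + e)^-1 *: x); last by rewrite scalerA mulfV ?scale1r ?gt_eqF.
  move=> w /vmax wx; rewrite dotpZr mulrC ler_pdivrMr // mul1r.
  by apply: le_trans wx _; rewrite lerDl ltW.
apply: le_ereal_inf_tmp => _ [t [t_ge0 [c c_polar ->]] <-].
by rewrite lee_fin dotpZr -[leRHS]mulr1 ler_wpM2l //; exact: c_polar.
Qed.

Lemma dotp_le_polar_gauge x w : V w -> dotp w x <= h x.
Proof. by have [v _ [_]] := polar_gaugeP x; apply. Qed.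

Lemma polar_gauge_ge0 x : 0 <= h x.
Proof. by rewrite -(dotp0l x) dotp_le_polar_gauge. Qed.

Lemma norm_dotp_le d v : V v -> `|dotp v d| <= h d + h (- d).
Proof.
move=> Vv; have := dotp_le_polar_gauge d Vv.
have := dotp_le_polar_gauge (- d) Vv; rewrite dotpNr => vNd vd.
have := polar_gauge_ge0 d; have := polar_gauge_ge0 (- d).
by rewrite ler_norml; lra.
Qed.

Lemma norm_dotpZ_le d v t : V v -> `|t * dotp v d| <= (h d + h (- d)) * `|t|.
Proof. by move=> Vv; rewrite normrM mulrC ler_wpM2r // norm_dotp_le. Qed.

Lemma polar_gauge_lipschitz x d t :
  `|h (x + t *: d) - h x| <= (h d + h (- d)) * `|t|.
Proof.
have [v Vv [vx _]] := polar_gaugeP x.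
have [w Vw [wxd _]] := polar_gaugeP (x + t *: d).
have := dotp_le_polar_gauge (x + t *: d) Vv.
have := dotp_le_polar_gauge x Vw.
move: wxd (norm_dotpZ_le d t Vv) (norm_dotpZ_le d t Vw).
by rewrite !dotpE !ler_norml; lra.
Qed.

(** The multiple r v of a maximizer v is the worst perturbation; no xi does
    better, since it is c scaled by t for some c in V and t close to r. *)
Lemma max_dotp_Xi r y : 0 <= r -> is_max [set dotp xi y | xi in Xi r V] (r * h y).
Proof.
move=> r_ge0; split.
  have [v Vv [vy _]] := polar_gaugeP y.
  exists (r *: v); last by rewrite dotpZl vy.
  by apply: ereal_inf_lbound; exists r => //; split => //; exists v.
move=> _ [xi xi_r <-]; apply/ler_addgt0Pr => e e_gt0.
have h1_gt0 : 0 < h y + 1 by rewrite ltr_wpDl ?polar_gauge_ge0.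
have re_gt : ((gauge V xi) < (r + e / (h y + 1))%:E)%E.
  by apply: le_lt_trans xi_r _; rewrite lte_fin ltrDl divr_gt0.
have [_ [t [t_ge0 [c Vc ->]] <-]] := ereal_inf_lt re_gt.
rewrite lte_fin dotpZl => /ltW t_le.
have cy := dotp_le_polar_gauge y Vc.
apply: le_trans (ler_wpM2l t_ge0 cy) _.
apply: le_trans (ler_wpM2r (polar_gauge_ge0 y) t_le) _.
rewrite mulrDl lerD2l mulrAC ler_pdivrMr // ler_pM2l //.
by rewrite lerDl.
Qed.

(** From an interior point one can still move a little in the direction x. *)
Lemma maximizer_not_interior x v :
  x != 0 -> dotp v x = h x -> ~ interior V v.
Proof.
move=> x_neq0 vx v_int.
have v_cvg : v + s *: x @[s --> (0 : R)^'+] --> v.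
  apply: cvg_at_right_filter; rewrite -[X in _ --> X]addr0.
  apply: cvgD; first exact: cvg_cst.
  by rewrite -(scale0r x); exact: cvgZr_tmp.
have /filter_ex [s [s_gt0 Vs]] :
    \forall s \near (0 : R)^'+, 0 < s /\ V (v + s *: x).
  by apply: filterI; [exact: nbhs_right_gt|exact: v_cvg].
have := dotp_le_polar_gauge x Vs; rewrite !dotpE vx gerDl leNgt.
by rewrite mulr_gt0 ?dotp_gt0.
Qed.

(** Two maximizers would both lie on the boundary, and their midpoint would be a
    maximizer in the interior. *)
Lemma maximizer_unique x v w : strictly_convex_set V -> x != 0 ->
  V v -> dotp v x = h x -> V w -> dotp w x = h x -> v = w.
Proof.
move=> [_ _ V_strict] x_neq0 Vv vx Vw wx; apply: contrapT => v_neqw.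
have bdry u : V u -> dotp u x = h x -> boundary V u.
  move=> Vu ux; split; first exact: subset_closure.
  exact: maximizer_not_interior ux.
have half : 0 < (2^-1 : R) < 1 by lra.
have := V_strict _ _ _ (bdry v Vv vx) (bdry w Vw wx) v_neqw half.
by apply: (maximizer_not_interior x_neq0); rewrite !dotpE vx wx; lra.
Qed.

(** The points w of V with <w, d> away from <v, d> form a compact set K without
    maximizers at x; the gap between h x and the maximum of <., x> on K survives
    small perturbations of x, so K contains no maximizers at x + t d either. *)
Lemma maximizer_cvg x v d e : strictly_convex_set V -> x != 0 ->
  V v -> dotp v x = h x -> 0 < e ->
  \forall t \near (0 : R)^', forall w, V w ->
    dotp w (x + t *: d) = h (x + t *: d) -> `|dotp w d - dotp v d| < e.
Proof.
move=> V_strict x_neq0 Vv vx e_gt0.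
pose K := V `&` [set w | e <= `|dotp w d - dotp v d|].
have K_compact : compact K.
  apply: compact_closedI => //.
  apply: (@preimage_closed _ _ (fun w => `|dotp w d - dotp v d|)
           [set r | e <= r]); last exact: closed_ge.
  move=> w _; have w_filter : Filter (nbhs w) := nbhs_filter w.
  apply: cvg_norm; apply: cvgB; last exact: cvg_cst.
  exact: dotp_continuous.
have [K_neq0|K0] := pselect (K !=set0); last first.
  near=> t => w Vw _; rewrite ltNge; apply/negP => wK.
  by apply: K0; exists w.
have [u /set_mem [Vu Ku] umax] : exists2 u, u \in K &
    forall w, w \in K -> dotp w x <= dotp u x.
  apply: EVT_max_rV => //.
  by apply: continuous_subspaceT => w; exact: dotp_continuous.
have ux : dotp u x < h x.
  rewrite lt_neqAle dotp_le_polar_gauge // andbT; apply/eqP => ux.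
  move: Ku; rewrite /= (maximizer_unique V_strict x_neq0 Vu ux Vv vx).
  by rewrite subrr normr0 leNgt e_gt0.
set B := h d + h (- d).
have B_ge0 : 0 <= B by rewrite addr_ge0 ?polar_gauge_ge0.
have B2_gt0 : 0 < 2 * B + 1 by lra.
near=> t => w Vw wxd; rewrite ltNge; apply/negP => wK.
have t_small : `|t| < (h x - dotp u x) / (2 * B + 1).
  by near: t; apply: dnbhs0_lt; rewrite divr_gt0 // subr_gt0.
rewrite ltr_pdivlMr // in t_small.
have wu : dotp w x <= dotp u x by apply: umax; apply/mem_set.
have := dotp_le_polar_gauge (x + t *: d) Vv.
move: wxd (norm_dotpZ_le d t Vv) (norm_dotpZ_le d t Vw) (normr_ge0 t).
rewrite -/B !dotpE !ler_norml => wxd /andP[v1 v2] /andP[w1 w2] t0 vxd.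
nra.
Unshelve. all: by end_near. Qed.

(** With w a maximizer at x + t d, the increment h (x + t d) - h x lies between
    t <v, d> and t <w, d>, and <w, d> tends to <v, d>. *)
Lemma polar_gauge_derive x v d : strictly_convex_set V -> x != 0 ->
  V v -> dotp v x = h x -> is_derive x d h (dotp v d).
Proof.
move=> V_strict x_neq0 Vv vx; apply/is_deriveP/cvgrPdist_lt => e e_gt0.
near=> t.
have t_neq0 : t != 0 by near: t; exact: nbhs_dnbhs_neq.
have [w Vw [wxd _]] := polar_gaugeP (x + t *: d).
have wvd : `|dotp w d - dotp v d| < e.
  by move: w Vw wxd; near: t; exact: maximizer_cvg.
apply: le_lt_trans wvd.
have wx := dotp_le_polar_gauge x Vw.
have vxd := dotp_le_polar_gauge (x + t *: d) Vv.
rewrite -(ler_pM2l (_ : 0 < `|t|)) ?normr_gt0 // -!normrM !(mulrBr t).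
rewrite mulrA mulfV // mul1r; apply: le_trans (ler_norm _).
by rewrite ler0_norm; move: wxd vxd; rewrite !dotpE; lra.
Unshelve. all: by end_near. Qed.

End SupportFunction.

(** * Real Legendre functions *)

Section LegendreFunction.
Context {R : realType} (g : R -> R).
Hypothesis g_legendre : legendre (lift1 g).

Lemma legendre_derivable a : derivable g a 1.
Proof.
have [_ _ g_diff _ _] := g_legendre; pose c (t : R) : 'rV[R]_1 := const_mx t.
have c_int : interior (domain (lift1 g)) (c a).
  have -> : domain (lift1 g) = setT by apply/seteqP; split=> // t _; exact: ltry.
  by rewrite interiorT.
have := @diff_derivable _ _ _ _ _ (c 1) (g_diff _ c_int).
suff E : (fun t => t^-1 *: ((g \o shift a) (t *: 1) - g a)) =
    (fun t => t^-1 *: (((fine \o lift1 g) \o shift (c a)) (t *: c 1) -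
                       (fine \o lift1 g) (c a))) by rewrite /derivable E.
by apply/funext => t /=; rewrite !mxE.
Qed.

(** A nonnegative convex function that vanishes at 0 is nondecreasing to the
    right of any a >= 0, since a is a convex combination of 0 and a + t. *)
Lemma legendre_derive1_ge0 a : (forall t, 0 <= g t) -> g 0 = 0 ->
  0 <= a -> 0 <= derive1 g a.
Proof.
move=> g_ge0 g0 a_ge0; have [[_ _ g_conv] _ _ _ _] := g_legendre.
rewrite derive1E; have g_der := derivableP (@legendre_derivable a).
apply: (derive_ge0_of_min g_der) => t /andP[t_gt0 _]; rewrite [_%:A]mulr1.
have at_gt0 : 0 < a + t by rewrite ltr_wpDl.
move: a_ge0; rewrite le_eqVlt => /predU1P[<-|a_gt0]; first by rewrite g0.
have lambda01 : 0 < a / (a + t) < 1.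
  by rewrite divr_gt0 //= ltr_pdivrMr // mul1r ltrDl.
have := g_conv (const_mx (a + t)) (const_mx 0) _ lambda01.
rewrite /lift1 !mxE g0 mulr0 addr0 divfK ?gt_eqF //.
rewrite -!EFinM -EFinD lee_fin mulr0 addr0 => /le_trans; apply.
by rewrite ler_piMl // ltW //; case/andP: lambda01.
Qed.

End LegendreFunction.

(** * The regularizer g (h x) *)

Section GaugeFunction.
Context {R : realType} {n : nat} (V : set 'rV[R]_n) (g : R -> R).
Hypotheses (V_compact : compact V) (V_int0 : interior V 0).
Hypotheses (V_strict : strictly_convex_set V).
Hypotheses (g_der : forall a, derivable g a 1) (dg0 : derive1 g 0 = 0).

Let h := polar_gauge V.

Lemma is_derive_gauge_function x v d : V v -> dotp v x = h x ->
  is_derive x d (g \o h) (dotp (derive1 g (h x) *: v) d).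
Proof.
move=> Vv vx; apply/is_deriveP.
have := @cvg_diffquot_comp _ g (fun t => h (x + t *: d)) (h d + h (- d)).
rewrite /= scale0r addr0; apply => [//|t|].
  exact: polar_gauge_lipschitz.
have [x0|x_neq0] := eqVneq x 0.
  have -> : derive1 g (h x) = 0 by rewrite -vx x0 dotpC dotp0l dg0.
  rewrite scale0r dotp0l; under eq_fun do rewrite mul0r; exact: cvg_cst.
rewrite dotpZl; apply: cvgM; first exact: cvg_cst.
by apply/is_deriveP; exact: polar_gauge_derive.
Qed.

Lemma gradient_gauge_function x v : V v -> dotp v x = h x ->
  gradient (g \o h) x = derive1 g (h x) *: v.
Proof.
by move=> Vv vx; apply: gradientE => d; exact: is_derive_gauge_function.
Qed.

End GaugeFunction.

(** * Normal cones and faces *)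

Section NormalCone.
Context {R : realType} {n : nat} (X : set 'rV[R]_n).
Implicit Types (x c : 'rV[R]_n).

Definition normal_cone x : set 'rV[R]_n :=
  [set c | forall y, X y -> dotp c (y - x) <= 0].

Lemma normal_coneD x c c' :
  normal_cone x c -> normal_cone x c' -> normal_cone x (c + c').
Proof.
by move=> cN c'N y Xy; rewrite dotpDl -(addr0 0) lerD ?cN ?c'N.
Qed.

(** Normality of c at x is validity on X of the inequality <c, .> <= <c, x>. *)
Lemma face_normal_cone x c :
  normal_cone x c -> face X (X `&` [set y | dotp c y = dotp c x]).
Proof.
move=> cN; exists c, (dotp c x); split=> // y Xy.
by have := cN y Xy; rewrite !dotpE subr_le0.
Qed.

(** The path stays in the face cut out by c, on which <c, .> is maximal over X. *)
Lemma normal_cone_monotone_path (x : nat -> 'rV[R]_n) c k m :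
  monotone_path X x -> X (x k) ->
  normal_cone (x k) c -> normal_cone (x (k + m)%N) c.
Proof.
move=> x_mono Xk cN; case: m => [|m]; first by rewrite addn0.
have [|_ cE y Xy] := x_mono _ (face_normal_cone cN) k _ m.+1 isT; first by split.
by have := cN y Xy; rewrite !dotpE cE.
Qed.

End NormalCone.

Lemma polyhedron_convex {R : realType} {n : nat} (X : set 'rV[R]_n) x y (t : R) :
  polyhedron X -> X x -> X y -> 0 < t < 1 -> X (x + t *: (y - x)).
Proof.
move=> [m [A [b ->]]] Ax Ay /andP[t_gt0 t_lt1] i.
by have := Ax i; have := Ay i; rewrite !dotpE; nra.
Qed.

(** * Optimality conditions along the proximal path *)

Section ProximalPath.
Context {R : realType} {n : nat} (X : set 'rV[R]_n) (f : 'rV[R]_n -> R).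
Hypothesis X_convex : forall x y (t : R), X x -> X y -> 0 < t < 1 ->
  X (x + t *: (y - x)).
Hypothesis f_der : forall x d, is_derive x d f (dotp (gradient f x) d).
Variables (a0 : 'rV[R]_n) (lambda : nat -> R) (x : nat -> 'rV[R]_n).
Hypothesis lambda_gt0 : forall k, 0 < lambda k.

Lemma is_derive_prox_objective mu y z d :
  is_derive y d (fun u => dotp a0 u + mu * bregman f u z)
    (dotp (a0 + mu *: (gradient f y - gradient f z)) d).
Proof.
apply/is_deriveP; have /is_deriveP fl := f_der y d.
rewrite dotpDl dotpZl dotpDl dotpNl.
have quot : dotp a0 d + mu * (t^-1 * (f (y + t *: d) - f y) - dotp (gradient f z) d)
    @[t --> 0^'] --> dotp a0 d + mu * (dotp (gradient f y) d - dotp (gradient f z) d).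
  apply: cvgD; first exact: cvg_cst.
  by apply: cvgM; [exact: cvg_cst|apply: cvgB; [exact: fl|exact: cvg_cst]].
apply: cvg_trans quot; apply: near_eq_cvg; near=> t.
have t_neq0 : t != 0 by near: t; exact: nbhs_dnbhs_neq.
by rewrite /bregman !dotpE; field.
Unshelve. all: by end_near. Qed.

Hypothesis x_prox : proximal_path X a0 f lambda x.

(** Moving from the minimizer towards any other point of X does not decrease the
    objective of the step. *)
Lemma prox_step_normal k :
  normal_cone X (x k.+1)
    (- ((lambda k)^-1 *: a0 + (gradient f (x k.+1) - gradient f (x k)))).
Proof.
move=> y Xy; have [Xk xmin] := x_prox k.
have := derive_ge0_of_min (is_derive_prox_objective (lambda k) _ (x k) (y - x k.+1)).
move=> /(_ (x k.+1)) /=.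
have min_seg t : 0 < t < 1 -> dotp a0 (x k.+1) + lambda k * bregman f (x k.+1) (x k) <=
    dotp a0 (x k.+1 + t *: (y - x k.+1)) +
    lambda k * bregman f (x k.+1 + t *: (y - x k.+1)) (x k).
  by move=> t01; apply: xmin; exact: X_convex.
move=> /(_ min_seg); rewrite dotpNl oppr_le0 => le0.
rewrite -(pmulr_rge0 _ (lambda_gt0 k)) -dotpZl scalerDr scalerA mulfV ?gt_eqF //.
by rewrite scale1r.
Qed.

Hypothesis x_mono : monotone_path X x.

(** Monotonicity carries the condition for the first steps over to the next
    iterate, where the gradients at the intermediate iterate cancel. *)
Lemma prox_path_normal k :
  normal_cone X (x k.+1)
    (- ((\sum_(i < k.+1) (lambda i)^-1) *: a0 +
        (gradient f (x k.+1) - gradient f (x 0%N)))).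
Proof.
elim: k => [|k IHk].
  by rewrite big_ord1; exact: prox_step_normal.
have [Xk _] := x_prox k.
have := normal_cone_monotone_path 1 x_mono Xk IHk; rewrite addn1 => IHk1.
have := normal_coneD IHk1 (prox_step_normal k.+1).
rewrite -opprD addrACA -scalerDl [X in _ -> _ (- (X *: _ + _))]big_ord_recr /=.
by rewrite [X in _ *: a0 + X]addrC subrKA.
Qed.

End ProximalPath.

(** The affine hull contains, with x and u, also the reflection 2 x - u of u, so
    that the derivative at the minimizer x towards u has both signs. *)
Lemma gradient_orth_of_affine_min {R : realType} {n : nat} (X : set 'rV[R]_n)
    (f : 'rV[R]_n -> R) x y z :
  (forall d, is_derive x d f (dotp (gradient f x) d)) ->
  argmin (Aff X) f x -> X y -> X z -> dotp (gradient f x) (y - z) = 0.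
Proof.
move=> f_der [Ax xmin] Xy Xz.
set A := Aff X in Ax xmin *.
have XA : X `<=` A by exact: sub_gen_smallest.
have A_affine : affine_set A.
  move=> u v t Au Av S S_over; have [S_affine _] := S_over.
  by apply: S_affine; [exact: Au|exact: Av].
have orth u : A u -> dotp (gradient f x) (u - x) = 0.
  have ge0 v : A v -> 0 <= dotp (gradient f x) (v - x).
    move=> Av; apply: derive_ge0_of_min (f_der (v - x)) _ => t _; apply: xmin.
    have -> : x + t *: (v - x) = t *: v + (1 - t) *: x.
      by rewrite scalerBr scalerBl scale1r addrCA addrA.
    exact: A_affine.
  move=> Au; apply/eqP; rewrite eq_le ge0 // andbT.
  have := ge0 _ (A_affine x u 2 Ax Au); rewrite !dotpE; lra.
have := orth y (XA y Xy); have := orth z (XA z Xz).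
by rewrite !dotpE; lra.
Qed.

(** * Robust optimality of the proximal path *)

Theorem theorem4 (R : realType) (n : nat)
    (X : set 'rV[R]_n) (X_poly : polyhedron X) (X_neq0 : X !=set0)
    (a0 : 'rV[R]_n)
    (V : set 'rV[R]_n) (V_compact : compact V) (V_smooth : smooth_set V)
    (V_strict : strictly_convex_set V) (V_int0 : interior V 0)
    (g : R -> R) (g_ge0 : forall t, 0 <= g t) (g_legendre : legendre (lift1 g))
    (g0 : g 0 = 0) (dg0 : derive1 g 0 = 0)
    (phi : 'rV[R]_n -> R) (phiE : forall x, phi x = g (polar_gauge V x))
    (lambda : nat -> R) (lambda_gt0 : forall k, 0 < lambda k)
    (lambda_div : (\sum_(i < k) (lambda i)^-1) @[k --> \oo] --> +oo)
    (x : nat -> 'rV[R]_n) (x0_min : argmin X phi (x 0%N))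
    (x_prox : proximal_path X a0 phi lambda x)
    (proj_eq : bregman_proj phi X 0 = bregman_proj phi (Aff X) 0)
    (x_mono : monotone_path X x)
    (k : nat) (k_ge1 : (1 <= k)%N) :
  let r := omega lambda k * derive1 g (polar_gauge V (x k)) in
  exists2 worst : 'rV[R]_n -> R,
    (forall y, X y ->
       is_max [set dotp (a0 + xi) y | xi in Xi r V] (worst y)) &
    argmin X worst (x k).
Proof.
case: k k_ge1 => // k _.
set h := polar_gauge V in phiE *; set om := omega lambda k.+1.
have phi_comp : phi = g \o h by apply/funext.
have g_der a : derivable g a 1 := @legendre_derivable _ _ g_legendre a.
have grad_phi z v : V v -> dotp v z = h z -> gradient phi z = derive1 g (h z) *: v.
  by rewrite phi_comp; exact: gradient_gauge_function.
have phi_der z d : is_derive z d phi (dotp (gradient phi z) d).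
  have [v Vv [vz _]] := polar_gaugeP V_compact V_int0 z.
  rewrite (grad_phi z v Vv vz) phi_comp; exact: is_derive_gauge_function.
have h0 : h 0 = 0.
  have [v _ [v0 _]] := polar_gaugeP V_compact V_int0 0.
  by rewrite /h -v0 dotpC dotp0l.
have bregman0 y : bregman phi y 0 = phi y.
  have [v Vv [v0 _]] := polar_gaugeP V_compact V_int0 0.
  by rewrite /bregman (grad_phi 0 v Vv v0) !phiE h0 dg0 g0 scale0r dotp0l !subr0.
have x0_aff : argmin (Aff X) phi (x 0%N).
  have : bregman_proj phi X 0 (x 0%N).
    by have [X0 x0_le] := x0_min; split=> // y Xy; rewrite !bregman0; exact: x0_le.
  rewrite proj_eq => -[A0 x0_le]; split=> // y Ay.
  by have := x0_le y Ay; rewrite !bregman0.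
have Xx j : X (x j) by case: j => [|j]; [case: x0_min|case: (x_prox j)].
have om_gt0 : 0 < om.
  rewrite invr_gt0 big_ord_recl ltr_pwDl ?invr_gt0 // sumr_ge0 // => i _.
  by rewrite invr_ge0 ltW.
move=> r; have r_ge0 : 0 <= r.
  apply: mulr_ge0; first exact: ltW.
  by apply: legendre_derive1_ge0 => //; exact: polar_gauge_ge0.
exists (fun y => dotp a0 y + r * h y) => [y Xy|].
  have [[xi xi_r xiy] ub] := max_dotp_Xi V_compact V_int0 y r_ge0.
  split; first by exists xi => //; rewrite dotpDl xiy.
  by move=> _ [z zr <-]; rewrite dotpDl lerD2l; apply: ub; exists z.
split=> // y Xy.
have [v Vv [vx _]] := polar_gaugeP V_compact V_int0 (x k.+1).
have stationary : 0 <= dotp (a0 + om *: gradient phi (x k.+1)) (y - x k.+1).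
  have orth := gradient_orth_of_affine_min (phi_der (x 0%N)) x0_aff Xy (Xx k.+1).
  have X_convex := polyhedron_convex X_poly.
  have := prox_path_normal X_convex phi_der lambda_gt0 x_prox x_mono k Xy.
  rewrite -[X in X *: a0]invrK -/(omega lambda k.+1) -/om dotpNl oppr_le0.
  rewrite -(pmulr_rge0 _ om_gt0) -dotpZl scalerDr scalerA mulfV ?gt_eqF //.
  by rewrite scale1r scalerBr !dotpDl !dotpNl !dotpZl orth mulr0 subr0.
have hy := ler_wpM2l r_ge0 (dotp_le_polar_gauge V_compact V_int0 y Vv).
move: stationary; rewrite (grad_phi _ _ Vv vx) scalerA -/r.
by rewrite !dotpE vx; move: hy; rewrite -/h; lra.
Qed.
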